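(* Let $q$ be an even prime power. Let $c\in \mathbb{F}_q$ be such that $t^2+t+c$ is an irreducible polynomial in $\mathbb{F}_q[t]$. Consider the homogeneous quadratic polynomials \begin{align*} f_0 &= x^2 + y^2 + xy + yz + c\,zw, \\ f_1 &= x^2 + z^2 + yz + xw \end{align*} in $\mathbb{F}_q[x,y,z,w]$. Then each of the $q+1$ distinct $\mathbb{F}_q$-members of the pencil $\langle f_0, f_1 \rangle$ is a smooth quadric surface in $\mathbb{P}^3$.
   Context: The $\mathbb{F}_q$-members of the pencil $\langle f_0,f_1\rangle$ are the quadric surfaces $\{s f_0+t f_1=0\}\subset\mathbb{P}^3$ with $[s:t]\in\mathbb{P}^1(\mathbb{F}_q)$. A hypersurface $\{F=0\}$ is smooth if there is no point over $\overline{\mathbb{F}}_q$ in projective space at which $F$ and all of its first-order partial derivatives vanish. *)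

(* Defs.v *)
From HB Require Import structures.
From mathcomp Require Import all_boot all_algebra all_field.
From mathcomp Require Import mpoly.
From mathcomp Require Import classical_sets cardinality.

Set Implicit Arguments.
Unset Strict Implicit.
Unset Printing Implicit Defensive.

Import GRing.Theory.

Local Open Scope ring_scope.

Definition algebraic_closure_of (F : fieldType) (K : closedFieldType)
    (iota : {rmorphism F -> K}) : Prop :=
  integralRange iota.

Section Hypersurfaces.

Variables (F : fieldType) (K : closedFieldType) (iota : {rmorphism F -> K}).
Variable n : nat.
Implicit Type p : {mpoly F[n.+1]}.

(* Points of P^n(K) are represented by their homogeneous coordinates, that is
   by nonzero vectors. *)
Definition vanishes_at p (v : 'rV[K]_n.+1) : Prop :=
  (map_mpoly iota p).@[v 0] = 0.

(* The hypersurface {p = 0} of P^n(K), given as the set of all the homogeneous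
   coordinates of its points. For homogeneous p this set is stable under
   nonzero scaling, so two hypersurfaces are equal in P^n(K) if and only if
   these sets are equal. *)
Definition hypersurface p : set 'rV[K]_n.+1 :=
  [set v | v != 0 /\ vanishes_at p v]%classic.

Definition smooth p : Prop :=
  ~ exists v : 'rV[K]_n.+1,
      [/\ v != 0, vanishes_at p v & forall i, vanishes_at p^`M(i) v].

Definition smooth_quadric p : Prop :=
  [/\ p != 0, p \is 2.-homog & smooth p].

(* The equation of the member of <f0, f1> at [s : t] = [st 0 0 : st 0 1]. *)
Definition pencil_eq (f0 f1 : {mpoly F[n.+1]}) (st : 'rV[F]_2) :
    {mpoly F[n.+1]} :=
  st 0 0 *: f0 + st 0 1 *: f1.

Definition pencil_members (f0 f1 : {mpoly F[n.+1]}) : set (set 'rV[K]_n.+1) :=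
  [set hypersurface (pencil_eq f0 f1 st) | st in [set st | st != 0]]%classic.

End Hypersurfaces.

Section Quadrics.

Variables (F : fieldType) (c : F).

Local Notation x := ('X_(@Ordinal 4 0 isT) : {mpoly F[4]}).
Local Notation y := ('X_(@Ordinal 4 1 isT) : {mpoly F[4]}).
Local Notation z := ('X_(@Ordinal 4 2 isT) : {mpoly F[4]}).
Local Notation w := ('X_(@Ordinal 4 3 isT) : {mpoly F[4]}).

Definition f0 : {mpoly F[4]} := x ^+ 2 + y ^+ 2 + x * y + y * z + c *: (z * w).
Definition f1 : {mpoly F[4]} := x ^+ 2 + z ^+ 2 + y * z + x * w.

End Quadrics.

Arguments f1 : clear implicits.

(* Main.v *)
Require Import Defs.
From mathcomp Require Import all_boot all_algebra all_field.
From mathcomp Require Import mpoly.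
From mathcomp Require Import classical_sets cardinality.
From mathcomp Require Import ring.

Set Implicit Arguments.
Unset Strict Implicit.
Unset Printing Implicit Defensive.

Import GRing.Theory.

Local Open Scope ring_scope.

(** Write [G = s f0 + t f1].  In characteristic 2 the partial derivatives of a
    quadratic form are the linear forms given by its polar form, which is
    alternating; for [G], in the coordinates [x, y, z, w], the Pfaffian of its
    matrix is
      [s * (s c) + t * (s + t) = t^2 + s t + c s^2],
    the homogenization of [t^2 + t + c].  As that polynomial is irreducible
    over the ground field, the Pfaffian is nonzero for every rational
    [(s, t) != (0, 0)] ([irreducible_quadratic_form]), so the four derivatives
    have no common zero other than the origin ([gradient_pencil_inj]) and every
    member is smooth.

    It remains to see that the members are pairwise distinct.  A point where
    [f0] and [f1] do not both vanish lies on exactly one member of the pencil.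
    On the line [y = w = 0] the pair [(f0, f1)] is [(x^2, x^2 + z^2)], and
    squaring is a bijection of a finite field of characteristic 2; so every
    nonzero pair of values is reached at a rational point ([quadrics_values]).
    Hence every member has a rational point off the base locus, and different
    points [[s : t]] of the projective line give different surfaces
    ([card_pencil_members]). *)

(** * Finite fields of characteristic 2 *)

Lemma even_card_pchar2 (F : finFieldType) : ~~ odd #|F| -> 2 \in [pchar F].
Proof.
move=> evF; have [p pr_p pcharFp] := finPcharP F.
suff -> : 2 = p by [].
apply/esym/(prime_oddPn pr_p); apply: contra evF => odd_p.
have -> : #|F| = (p ^ logn p #|F|)%N := card_pprimeChar pcharFp.
by rewrite oddX odd_p orbT.
Qed.

Lemma pchar2_sqrt (F : finFieldType) : 2 \in [pchar F] ->
  forall a : F, exists x, x ^+ 2 = a.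
Proof.
move=> F2 a; have [g _ gK] := injF_bij (fmorph_inj (pFrobenius_aut F2)).
by exists (g a); exact: gK.
Qed.

(** A zero with [s != 0] would give the root [t / s] of the irreducible
    polynomial, and at [s = 0] only the monic term [t ^+ 2] remains. *)
Lemma irreducible_quadratic_form (F : fieldType) (c s t : F) :
    irreducible_poly ('X^2 + 'X + c%:P) -> (s != 0) || (t != 0) ->
  t ^+ 2 + s * t + c * s ^+ 2 != 0.
Proof.
move=> irr; have [-> /= tN0 | sN0 _] := eqVneq s 0.
  by rewrite mul0r expr0n mulr0 !addr0 expf_neq0.
apply/eqP => st0.
have size_p : size ('X^2 + 'X + c%:P : {poly F}) = 3.
  by rewrite -addrA size_polyDl ?size_polyXn // size_XaddC.
have root_p : root ('X^2 + 'X + c%:P) (t / s).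
  apply/eqP; rewrite !hornerE.
  have -> : (t / s) ^+ 2 + t / s + c
          = (t ^+ 2 + s * t + c * s ^+ 2) / s ^+ 2 by field.
  by rewrite st0 mul0r.
have := apply_irredp irr (q := 'X - (t / s)%:P); rewrite dvdp_XsubCl.
by rewrite size_XsubC => /(_ isT root_p)/eqp_size; rewrite size_p size_XsubC.
Qed.

(** * Counting the members of a pencil *)

Lemma rV2P (R : Type) (u v : 'rV[R]_2) :
  u 0 0 = v 0 0 -> u 0 1 = v 0 1 -> u = v.
Proof.
move=> uv0 uv1; apply/rowP=> j.
by have [->|->] : j = 0 \/ j = 1; first by case: j => -[|[|//]] lt_j;
  [left | right]; apply: val_inj.
Qed.

Lemma rV2_neq0 (V : nmodType) (u : 'rV[V]_2) :
  (u != 0) = (u 0 0 != 0) || (u 0 1 != 0).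
Proof.
rewrite -negb_and; congr (~~ _); apply/eqP/andP=> [->|[/eqP u0 /eqP u1]].
  by rewrite !mxE.
by apply: rV2P; rewrite mxE.
Qed.

Lemma meval_map_mpoly (R S : nzRingType) (iota : {rmorphism R -> S}) n
    (p : {mpoly R[n]}) (u : 'I_n -> R) :
  (map_mpoly iota p).@[fun i => iota (u i)] = iota p.@[u].
Proof.
elim/mpolyind: p => [|a m p _ _ IHp]; first by rewrite !raddf0.
rewrite !(raddfD, mevalD) /= map_mpolyZ map_mpolyX !mevalZ !mevalX IHp.
rewrite /= rmorphM rmorph_prod; congr (_ * _ + _).
by apply: eq_bigr => i _; rewrite rmorphXn.
Qed.

Lemma vanishes_at_pencil_eq (F : fieldType) (K : closedFieldType)
    (iota : {rmorphism F -> K}) n (f0 f1 : {mpoly F[n.+1]}) st v :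
  vanishes_at iota (pencil_eq f0 f1 st) v <->
  iota (st 0 0) * (map_mpoly iota f0).@[v 0]
    + iota (st 0 1) * (map_mpoly iota f1).@[v 0] = 0.
Proof. by rewrite /vanishes_at raddfD /= !map_mpolyZ mevalD !mevalZ. Qed.

(** One representative for each point of the projective line: [[1 : a]] for
    [Some a], and the point at infinity [[0 : 1]] for [None]. *)
Definition line_point (F : fieldType) (o : option F) : 'rV[F]_2 :=
  if o is Some a then \row_j [:: 1; a]`_j else \row_j [:: 0; 1]`_j.

Lemma line_point_neq0 (F : fieldType) (o : option F) : line_point o != 0.
Proof. by rewrite rV2_neq0; case: o => [a|]; rewrite !mxE oner_eq0 ?orbT. Qed.

Section CountMembers.

Variables (F : fieldType) (K : closedFieldType) (iota : {rmorphism F -> K}).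
Variables (n : nat) (f0 f1 : {mpoly F[n.+1]}).

Lemma hypersurface_pencilZ (a : F) st : a != 0 ->
  hypersurface iota (pencil_eq f0 f1 (a *: st))
  = hypersurface iota (pencil_eq f0 f1 st).
Proof.
move=> aN0; apply/seteqP; split=> v [vN0 /vanishes_at_pencil_eq v0].
all: split=> //; apply/vanishes_at_pencil_eq; move: v0; rewrite !mxE !rmorphM.
  rewrite -!mulrA -mulrDr => /eqP; rewrite mulf_eq0 fmorph_eq0 (negPf aN0).
  by move/eqP.
by rewrite -!mulrA -mulrDr => ->; rewrite mulr0.
Qed.

Lemma pencil_members_range :
  pencil_members iota f0 f1
  = range (fun o => hypersurface iota (pencil_eq f0 f1 (line_point o))).
Proof.
apply/seteqP; split=> [_ [st stN0 <-] | _ [o _ <-]]; last first.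
  by exists (line_point o); first exact: line_point_neq0.
move: stN0; rewrite /= rV2_neq0; have [s0 /= tN0 | sN0 _] := eqVneq (st 0 0) 0.
  exists None => //; rewrite -(@hypersurface_pencilZ (st 0 1)) //.
  congr (hypersurface _ (pencil_eq _ _ _)).
  by apply: rV2P; rewrite !mxE /= ?mulr0 ?mulr1.
exists (Some (st 0 1 / st 0 0)) => //.
rewrite -(@hypersurface_pencilZ (st 0 0)) //.
congr (hypersurface _ (pencil_eq _ _ _)).
by apply: rV2P; rewrite !mxE /= ?mulr1 // mulrC divfK.
Qed.

Hypothesis values : forall a b : F, (a != 0) || (b != 0) ->
  exists2 u : 'rV[F]_n.+1, u != 0 & f0.@[u 0] = a /\ f1.@[u 0] = b.

(** Every member [[s : t]] has a rational point at which [(f0, f1)] takes the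
    value [(t, - s)]; such a point lies on no other member. *)
Lemma pencil_hypersurface_inj (st st' : 'rV[F]_2) : st != 0 ->
    hypersurface iota (pencil_eq f0 f1 st)
      = hypersurface iota (pencil_eq f0 f1 st') ->
  st' 0 0 * st 0 1 = st' 0 1 * st 0 0.
Proof.
move=> stN0 eqH.
have [|u uN0 [f0u f1u]] := @values (st 0 1) (- st 0 0).
  by rewrite oppr_eq0 orbC -rV2_neq0.
have map_u f : (map_mpoly iota f).@[map_mx iota u 0] = iota f.@[u 0].
  rewrite -meval_map_mpoly; apply: meval_eq => i; exact: mxE.
have : hypersurface iota (pencil_eq f0 f1 st) (map_mx iota u).
  split; first by rewrite map_mx_eq0.
  apply/vanishes_at_pencil_eq; rewrite !map_u f0u f1u -!rmorphM -rmorphD.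
  by rewrite mulrN mulrC subrr rmorph0.
rewrite eqH => -[_ /vanishes_at_pencil_eq]; rewrite !map_u f0u f1u.
rewrite -!rmorphM -rmorphD mulrN => /eqP.
by rewrite fmorph_eq0 subr_eq0 => /eqP.
Qed.

End CountMembers.

(** The hypothesis on the values gives every member a rational point off the
    base locus, so that distinct points of the projective line, of which there
    are [#|F|.+1], give distinct members. *)
Lemma card_pencil_members (F : finFieldType) (K : closedFieldType)
    (iota : {rmorphism F -> K}) n (f0 f1 : {mpoly F[n.+1]}) :
    (forall a b : F, (a != 0) || (b != 0) ->
       exists2 u : 'rV[F]_n.+1, u != 0 & f0.@[u 0] = a /\ f1.@[u 0] = b) ->
  (pencil_members iota f0 f1 #= `I_#|F|.+1)%card.
Proof.
move=> values; rewrite pencil_members_range -card_option.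
pose H o := hypersurface iota (pencil_eq f0 f1 (line_point o)).
have inj_H : injective H.
  move=> o o' /(pencil_hypersurface_inj values (line_point_neq0 o)).
  by case: o o' => [a|] [b|]; rewrite !mxE /= ?(mul0r, mulr0, mul1r, mulr1) //;
    [move=> -> | move/eqP; rewrite eq_sym oner_eq0 | move/eqP; rewrite oner_eq0].
have -> : range H = range (H \o (enum_val : 'I_#|{: option F}| -> _)).
  apply/seteqP; split=> _ [o _ <-]; last by exists (enum_val o).
  by exists (enum_rank o) => //=; rewrite enum_rankK.
rewrite (card_eqr card_II); apply: inj_card_eq => i j _ _ /inj_H.
exact: enum_val_inj.
Qed.

(** * The pencil spanned by the two quadrics *)

Lemma mderivXU (R : nzRingType) n (i j : 'I_n) :
  ('X_i : {mpoly R[n]})^`M(j) = (i == j)%:R%:MP.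
Proof.
rewrite mderivX mnm1E; have [-> | _] := eqVneq; last by rewrite scale0r mpolyC0.
have -> : (U_(j) - U_(j) = 0)%MM by apply/mnmP=> k; rewrite mnmBE mnm0E subnn.
by rewrite scale1r mpolyX0 mpolyC1.
Qed.

(** Every point is a singular zero of the zero polynomial. *)
Lemma smooth_neq0 (F : fieldType) (K : closedFieldType)
    (iota : {rmorphism F -> K}) n (p : {mpoly F[n.+1]}) :
  smooth iota p -> p != 0.
Proof.
move=> smooth_p; apply/eqP=> p0; case: smooth_p; exists (const_mx 1).
rewrite p0 /vanishes_at; split=> [||i]; rewrite ?mderiv0 ?raddf0 //.
by apply/eqP=> /rowP/(_ 0)/eqP; rewrite !mxE oner_eq0.
Qed.

Lemma homog_pencil_eq (F : fieldType) (c : F) st :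
  pencil_eq (f0 c) (f1 F) st \is 2.-homog.
Proof.
have hX (i j : 'I_4) : ('X_i * 'X_j : {mpoly F[4]}) \is 2.-homog.
  by rewrite -mpolyXD dhomogX; rewrite /= mdegD !mdeg1.
by rewrite /pencil_eq /f0 /f1 !expr2 !(dhomogD, dhomogZ, hX).
Qed.

(** The line [y = w = 0] suffices: on it [f0 = x^2] and [f1 = x^2 + z^2]. *)
Lemma quadrics_values (F : finFieldType) (c a b : F) : 2 \in [pchar F] ->
    (a != 0) || (b != 0) ->
  exists2 u : 'rV[F]_4, u != 0 & (f0 c).@[u 0] = a /\ (f1 F).@[u 0] = b.
Proof.
move=> F2 abN0; have [x x2] := pchar2_sqrt F2 a.
have [z z2] := pchar2_sqrt F2 (b - a).
exists (\row_j [:: x; 0; z; 0]`_j); last first.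
  rewrite /f0 /f1 !(mevalD, mevalM, mevalZ, mevalXU, expr2) !mxE /=.
  rewrite !(mul0r, mulr0, addr0) -!expr2 x2 z2; split=> //.
  by rewrite addrC subrK.
apply: contraL abN0 => /eqP/rowP u0.
have:= u0 (@Ordinal 4 0 isT); have:= u0 (@Ordinal 4 2 isT); rewrite !mxE /=.
move=> z0 x0; move: x2 z2; rewrite x0 z0 expr0n /= => <-.
by rewrite subr0 => <-; rewrite eqxx.
Qed.

(** The vanishing of the derivatives says that [v] is in the radical of the
    polar form, whose matrix [M] is alternating of size 4.  Such a matrix has an
    alternating companion [N], with the entries of [M] permuted up to sign, such that
    [N *m M] is the scalar matrix of the Pfaffian of [M]; here each row of [N]
    has two nonzero entries, so each coordinate of [v] times the Pfaffian is a
    combination of two of the derivatives. *)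
Lemma gradient_pencil_inj (F : fieldType) (c : F) (K : closedFieldType)
    (iota : {rmorphism F -> K}) (st : 'rV[F]_2) (v : 'rV[K]_4) :
    2 \in [pchar F] ->
    st 0 1 ^+ 2 + st 0 0 * st 0 1 + c * st 0 0 ^+ 2 != 0 ->
    (forall i, vanishes_at iota (pencil_eq (f0 c) (f1 F) st)^`M(i) v) ->
  v = 0.
Proof.
move=> F2 PfN0 grad0.
have K2 : 2 \in [pchar K] by apply: rmorph_pchar F2.
set s := st 0 0 in PfN0; set t := st 0 1 in PfN0.
have two0 : 2 = 0 :> K := pcharf0 K2.
pose Pf := iota t ^+ 2 + iota s * iota t + iota c * iota s ^+ 2.
have {}PfN0 : Pf != 0.
  by rewrite /Pf -!rmorphXn -!rmorphM -!rmorphD fmorph_eq0.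
(* The term [2 * r] makes room for the cancellations that are special to
   characteristic 2, so that each use of [coord0] rests on an identity valid
   in every commutative ring. *)
have coord0 (a p q r e1 e2 : K) : e1 = 0 -> e2 = 0 ->
    Pf * a = p * e1 + q * e2 - 2 * r -> a = 0.
  move=> -> -> /eqP; rewrite two0 !(mulr0, mul0r) subr0 addr0.
  by rewrite mulf_eq0 (negPf PfN0) => /eqP.
pose x := v 0 (@Ordinal 4 0 isT); pose y := v 0 (@Ordinal 4 1 isT).
pose z := v 0 (@Ordinal 4 2 isT); pose w := v 0 (@Ordinal 4 3 isT).
have /= := grad0 (@Ordinal 4 0 isT); have /= := grad0 (@Ordinal 4 1 isT).
have /= := grad0 (@Ordinal 4 2 isT); have /= := grad0 (@Ordinal 4 3 isT).
rewrite /vanishes_at /pencil_eq /f0 /f1.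
rewrite !(mderivD, mderivZ, mderivM, mderivXU, expr2) /= mpolyC0 mpolyC1.
rewrite !(mul0r, mulr0, mul1r, mulr1, add0r, addr0, scaler0).
do 3! rewrite ?(rmorphD, map_mpolyZ, map_mpolyX) /=.
rewrite !(mevalD, mevalZ, mevalXU) -/s -/t -/x -/y -/z -/w.
rewrite !(addrr_pchar2 K2) !add0r.
move=> dw dz dy dx.
have x0 : x = 0.
  apply: (coord0 _ (iota s * iota c) (iota s + iota t)
                 (iota s * iota c * (iota s + iota t) * z) _ _ dy dw).
  by rewrite /Pf; ring.
have y0 : y = 0.
  apply: (coord0 _ (iota s * iota c) (iota t)
                 (iota s * iota c * iota t * w) _ _ dx dz).
  by rewrite /Pf; ring.
have z0 : z = 0.
  apply: (coord0 _ (iota t) (iota s) (iota s * iota t * x) _ _ dy dw).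
  by rewrite /Pf; ring.
have w0 : w = 0.
  apply: (coord0 _ (iota s + iota t) (iota s)
                 (iota s * (iota s + iota t) * y) _ _ dx dz).
  by rewrite /Pf; ring.
apply/rowP=> -[] [|[|[|[|//]]]] lt_j; rewrite mxE.
- by rewrite -[RHS]x0; congr (v 0 _); apply: val_inj.
- by rewrite -[RHS]y0; congr (v 0 _); apply: val_inj.
- by rewrite -[RHS]z0; congr (v 0 _); apply: val_inj.
- by rewrite -[RHS]w0; congr (v 0 _); apply: val_inj.
Qed.

Theorem proposition3p5 (F : finFieldType) (q : nat) (hF : #|F| = q)
    (hq : ~~ odd q) (c : F)
    (hc : irreducible_poly ('X^2 + 'X + c%:P : {poly F}))
    (K : closedFieldType) (iota : {rmorphism F -> K})
    (hK : algebraic_closure_of iota) :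
  (pencil_members iota (f0 c) (f1 F) #= `I_q.+1)%card /\
  (forall st : 'rV[F]_2, st != 0 ->
     smooth_quadric iota (pencil_eq (f0 c) (f1 F) st)).
Proof.
move: hq; rewrite -hF => /even_card_pchar2 F2; split.
  by apply: card_pencil_members => a b; apply: quadrics_values.
move=> st stN0.
have smooth_st : smooth iota (pencil_eq (f0 c) (f1 F) st).
  case=> v [vN0 _ grad0]; case/eqP: vN0.
  apply: gradient_pencil_inj grad0 => //; apply: irreducible_quadratic_form => //.
  by rewrite -rV2_neq0.
split=> //; first exact: smooth_neq0 smooth_st.
exact: homog_pencil_eq.
Qed.
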